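(* Let $n\ge 0$ and $g\ge1$ be integers and let $F$ be an irreducible finite-dimensional representation of $\mathrm{Sp}(g)$ with highest weight $(a_1,\dots,a_g)$, where $n\ge a_1\ge\dots\ge a_g\ge0$. Let $S(S^2W)$ act on $F$ through the identification of $S^2W$ with the abelian subalgebra of $\mathfrak{sp}(g)$ described in the context. Then the ideal of $S(S^2W)$ generated by the image of $P_{n+1}:S^{2n+2}W\to S^{n+1}(S^2W)$ annihilates $F$.
   Context: Here $W=\mathbb{C}^g$ with basis $e_1,\dots,e_g$, and $\mathfrak{sp}(g)$ is realized as the $2g\times 2g$ block matrices $\begin{pmatrix}\mathbf a&\mathbf b\\ \mathbf c&-\mathbf a^T\end{pmatrix}$ with $\mathbf b,\mathbf c$ symmetric. The element $L_{ij}=e_ie_j\in S^2W$ is identified with the matrix having $\frac12(E_{ij}+E_{ji})$ in the $\mathbf b$-block and zeros elsewhere ($E_{ij}$ the elementary matrix); these commute, so $S(S^2W)$ acts on every representation of $\mathfrak{sp}(g)$. For $k\ge1$, $P_k$ sends $e_{i_1}\cdots e_{i_{2k}}$ to the sum over all partitions of the positions $\{1,\dots,2k\}$ into unordered pairs $\{a_1,b_1\},\dots,\{a_k,b_k\}$ of $L_{i_{a_1}i_{b_1}}\cdots L_{i_{a_k}i_{b_k}}$. Highest weights $(a_1,\dots,a_g)$ are written in the standard coordinates: $a_1\epsilon_1+\dots+a_g\epsilon_g$ w.r.t. the torus $\mathrm{diag}(t_1,\dots,t_g,t_1^{-1},\dots,t_g^{-1})$. *)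

(* Defs.v *)
From HB Require Import structures.
From mathcomp Require Import all_boot all_order all_algebra all_fingroup.
From mathcomp Require Import mpoly.
Set Implicit Arguments. Unset Strict Implicit. Unset Printing Implicit Defensive.
Import GRing.Theory.
Local Open Scope ring_scope.

Definition is_sp (C : numClosedFieldType) (g : nat) (X : 'M[C]_(g + g)) : Prop :=
  exists (a b c : 'M[C]_g),
    X = block_mx a b c (- a^T) /\ b^T = b /\ c^T = c.

(* L_ij = e_i e_j in S^2 W, as the matrix with (E_ij + E_ji)/2 in the b-block. *)
Definition Lmat (C : numClosedFieldType) (g : nat) (i j : 'I_g) : 'M[C]_(g + g) :=
  block_mx 0 (2^-1 *: (delta_mx i j + delta_mx j i)) 0 0.

Definition is_sp_rep (C : numClosedFieldType) (g m : nat)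
    (rho : 'M[C]_(g + g) -> 'M[C]_(m.+1)) : Prop :=
  (forall (k : C) X Y, is_sp X -> is_sp Y -> rho (k *: X + Y) = k *: rho X + rho Y) /\
  (forall X Y, is_sp X -> is_sp Y ->
     rho (X *m Y - Y *m X) = rho X *m rho Y - rho Y *m rho X).

(* Irreducible: every sp(g)-stable subspace of column vectors is 0 or everything.
   A subspace is encoded by a matrix U whose rows are the transposes of its vectors. *)
Definition is_irreducible_rep (C : numClosedFieldType) (g m : nat)
    (rho : 'M[C]_(g + g) -> 'M[C]_(m.+1)) : Prop :=
  forall U : 'M[C]_(m.+1),
    (forall X, is_sp X -> (U *m (rho X)^T <= U)%MS) -> U = 0 \/ row_full U.

(* Cartan element diag(h, -h), and positive root vectors for the Borel whose
   positive roots are eps_i - eps_j (i<j) and eps_i + eps_j (i <= j). *)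
Definition cartan_elt (C : numClosedFieldType) (g : nat) (d : 'rV[C]_g) : 'M[C]_(g + g) :=
  block_mx (diag_mx d) 0 0 (- diag_mx d).
Definition root_vec_A (C : numClosedFieldType) (g : nat) (i j : 'I_g) : 'M[C]_(g + g) :=
  block_mx (delta_mx i j) 0 0 (- (delta_mx i j)^T).
Definition root_vec_B (C : numClosedFieldType) (g : nat) (i j : 'I_g) : 'M[C]_(g + g) :=
  block_mx 0 (delta_mx i j + delta_mx j i) 0 0.

Definition is_highest_weight (C : numClosedFieldType) (g m : nat)
    (rho : 'M[C]_(g + g) -> 'M[C]_(m.+1)) (a : 'I_g -> nat) : Prop :=
  exists v : 'cV[C]_(m.+1),
    v != 0 /\
    (forall d : 'rV[C]_g, rho (@cartan_elt C g d) *m v = (\sum_i (a i)%:R * d 0 i) *: v) /\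
    (forall i j : 'I_g, (i < j)%N -> rho (@root_vec_A C g i j) *m v = 0) /\
    (forall i j : 'I_g, (i <= j)%N -> rho (@root_vec_B C g i j) *m v = 0).

(* S(S^2 W) is realized inside the polynomial ring in variables x_(i,j),
   (i,j) : 'I_g * 'I_g, as the subring of polynomials only involving the
   variables x_(i,j) with i <= j (x_(i,j) standing for L_ij = e_i e_j). *)
Definition nvars (g : nat) : nat := #|{: 'I_g * 'I_g}|.

Definition in_SS2W (C : numClosedFieldType) (g : nat) (q : {mpoly C[nvars g]}) : Prop :=
  forall mon, mon \in msupp q ->
    forall i j : 'I_g, (j < i)%N -> mon (enum_rank (i, j)) = 0%N.

Definition Lvar (C : numClosedFieldType) (g : nat) (i j : 'I_g) : {mpoly C[nvars g]} :=
  if (i <= j)%N then 'X_(enum_rank (i, j)) else 'X_(enum_rank (j, i)).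

(* Partitions of {0,...,2k-1} into unordered pairs = fixed-point-free involutions. *)
Definition is_pairing (N : nat) (s : {perm 'I_N}) : bool :=
  [forall x, (s (s x) == x) && (s x != x)].

(* P_k (e_{i_1} ... e_{i_{2k}}) = sum over pairings of prod over pairs of L_{i_a i_b}. *)
Definition Pk (C : numClosedFieldType) (g k : nat) (I : 'I_(k.*2) -> 'I_g)
  : {mpoly C[nvars g]} :=
  \sum_(s : {perm 'I_(k.*2)} | is_pairing s)
     \prod_(x : 'I_(k.*2) | (x < s x)%N) Lvar C (I x) (I (s x)).

Definition in_ideal_Pk (C : numClosedFieldType) (g k : nat) (p : {mpoly C[nvars g]}) : Prop :=
  exists (K : nat) (q : 'I_K -> {mpoly C[nvars g]}) (I : 'I_K -> ('I_(k.*2) -> 'I_g)),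
    (forall t, in_SS2W (q t)) /\ p = \sum_(t < K) q t * Pk C (I t).

Definition act_S (C : numClosedFieldType) (g m : nat)
    (rho : 'M[C]_(g + g) -> 'M[C]_(m.+1)) (p : {mpoly C[nvars g]}) : 'M[C]_(m.+1) :=
  mmap (fun c : C => c%:M) (fun t => rho (@Lmat C g (enum_val t).1 (enum_val t).2)) p.

(* Main.v *)
(** By induction on the number of entries of I different from the first index,
    P_{n+1}(e_I) kills F as soon as L_11^{n+1} does: F is acted on by the
    lowering operators Y_j (the matrix unit E_j1 of gl(g)), the commutator of
    Y_j with P(e_I) is the sum of the P(e_I') where I' is I with one entry 1
    replaced by j, and P(e_I) does not depend on the order of the entries.
    For L_11 = E, complete to an sl_2-triple (E, H, F) and grade sp(g) by H,
    with degrees -2, ..., 2. The vectors obtained below the highest weight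
    vector are H-weight vectors of weight at most a_1 and span F. A weight
    below -a_1 would produce, by raising a lowest vector with E, a weight
    above a_1; so all weights lie in [-a_1, a_1] and E^{n+1}, which shifts
    weights by 2n+2 > 2a_1, vanishes. *)
Require Import Defs.
From HB Require Import structures.
From mathcomp Require Import all_boot all_order all_algebra all_fingroup.
From mathcomp Require Import mpoly.
From mathcomp Require Import zify.
From Stdlib Require Import Classical.
Set Implicit Arguments. Unset Strict Implicit. Unset Printing Implicit Defensive.
Import Order.TTheory GRing.Theory Num.Theory.
Local Open Scope ring_scope.

(** * Pairing sums *)

Section Pairings.
Variable N : nat.
Implicit Type s : {perm 'I_N}.

Lemma pairingP s :
  reflect (involutive s /\ forall x, s x != x) (is_pairing s).
Proof.
apply: (iffP forallP) => [h|[sK sN] x]; last by rewrite sK sN eqxx.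
by split=> x; case/andP: (h x) => // /eqP.
Qed.

Lemma pairing_ltn_swap s x : is_pairing s -> (s x < s (s x))%N = ~~ (x < s x)%N.
Proof.
case/pairingP=> sK sN; rewrite sK -leqNgt [RHS]leq_eqVlt.
by have /negbTE := sN x; rewrite -val_eqE /= => ->.
Qed.

Lemma is_pairingJ s t : is_pairing (s ^ t)%g = is_pairing s.
Proof.
suff imp (u v : {perm 'I_N}) : is_pairing u -> is_pairing (u ^ v)%g.
  by apply/idP/idP => [h|]; [rewrite -(conjgK t s)|]; apply: imp.
case/pairingP=> uK uN; apply/pairingP; split=> x.
  by rewrite -(permKV v x) !permJ uK.
by rewrite -(permKV v x) permJ (inj_eq perm_inj) uN.
Qed.

Lemma sum_pairing (R : nmodType) s (G : 'I_N -> R) : is_pairing s ->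
  \sum_x G x = \sum_(x : 'I_N | (x < s x)%N) (G x + G (s x)).
Proof.
move=> hs; case/pairingP: (hs) => sK sN.
rewrite big_split /= (bigID (fun x : 'I_N => (x < s x)%N)) /=; congr (_ + _).
rewrite [RHS](reindex_inj (@perm_inj _ s)) /=.
apply: eq_big => x; last by rewrite sK.
by rewrite pairing_ltn_swap.
Qed.

Lemma card_pairing s : is_pairing s -> N = (#|[pred x : 'I_N | (x < s x)%N]|).*2.
Proof.
move=> hs; have := sum_pairing (fun=> 1%N) hs.
by rewrite sum1_card card_ord sum_nat_const muln2.
Qed.

(** Both [B] and [x < s x] pick one point from each pair of [s]; [f] and [f'] translate between the
    two choices, and the symmetry of [G] makes the factor of a pair independent of the choice. *)
Lemma prod_pairing_half (R : comPzRingType) s (B : pred 'I_N) (G : 'I_N -> 'I_N -> R) :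
    is_pairing s -> (forall x y, G x y = G y x) -> (forall x, B (s x) = ~~ B x) ->
  \prod_(x | B x) G x (s x) = \prod_(x : 'I_N | (x < s x)%N) G x (s x).
Proof.
move=> hs GC Bs; case/pairingP: (hs) => sK sN.
pose f (x : 'I_N) := if B x then x else s x.
pose f' (x : 'I_N) := if (x < s x)%N then x else s x.
rewrite (reindex_onto f f') => [|x Bx].
  apply: eq_big => x; last by move=> _; rewrite /f; case: ifP; rewrite ?sK.
  rewrite /f /f'; case: (boolP (B x)) => [Bx|nBx].
    by rewrite Bx; case: (x < s x)%N; rewrite ?eqxx ?(negbTE (sN x)).
  rewrite Bs nBx pairing_ltn_swap //; case: (x < s x)%N; rewrite /= ?sK ?eqxx //.
  by rewrite (negbTE (sN x)).
by rewrite /f /f'; case: (x < s x)%N; rewrite ?Bs Bx //= sK.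
Qed.

End Pairings.

Lemma LvarC (C : numClosedFieldType) g (i j : 'I_g) : Lvar C i j = Lvar C j i.
Proof.
rewrite /Lvar; case: (ltngtP i j) => // eij.
by have -> : i = j by apply: val_inj.
Qed.

(* The product over x < s x changes under reordering of 'I_N by swaps inside pairs only. *)
Lemma Pk_perm (C : numClosedFieldType) g k (I : 'I_(k.*2) -> 'I_g) (t : {perm 'I_(k.*2)}) :
  Pk C (I \o t) = Pk C I.
Proof.
rewrite /Pk [RHS](reindex_inj (@conjg_inj _ t)) /=.
apply: eq_big => s; first by rewrite is_pairingJ.
(* [B] picks from each pair of [s ^ t] the image under [t] of the smaller point of a pair of [s];
   this image need not be the smaller point of its own pair. *)
move=> hs; pose B (y : 'I_(k.*2)) := (t^-1 y < s (t^-1 y))%g%N.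
rewrite (reindex_inj (@perm_inj _ t^-1%g)) /=.
have Bst y : B ((s ^ t)%g y) = ~~ B y.
  rewrite /B -{1 2}(permKV t y) permJ permK pairing_ltn_swap //.
rewrite -(prod_pairing_half (B := B) (G := fun x y => Lvar C (I x) (I y))) //.
- apply: eq_bigr => y _; rewrite permKV.
  by rewrite !permM.
- by rewrite is_pairingJ.
by move=> x y; rewrite LvarC.
Qed.

Definition subst_at N (T : Type) (I : 'I_N -> T) (x : 'I_N) (j : T) : 'I_N -> T :=
  fun y => if y == x then j else I y.

(** * Evaluating polynomials at commuting elements of a noncommutative ring *)

Section Commuting.
Variables (n : nat) (R : nzRingType) (C : comNzRingType).
Variables (f : {rmorphism C -> R}) (h : 'I_n -> R).
Hypothesis hC : forall i j, GRing.comm (h i) (h j).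
Hypothesis fC : forall c x, GRing.comm (f c) x.

Lemma mmap1M_commuting m1 m2 : mmap1 h (m1 + m2)%MM = mmap1 h m1 * mmap1 h m2.
Proof.
rewrite /mmap1; elim: (index_enum _) => [|i r IHr]; first by rewrite !big_nil mul1r.
rewrite !big_cons mnmDE exprD IHr -!mulrA; congr (_ * _); rewrite !mulrA; congr (_ * _).
by apply: commr_prod => j _; apply: commrX; apply/commr_sym/commrX.
Qed.

Lemma mmapM_commuting (p q : {mpoly C[n]}) : mmap f h (p * q) = mmap f h p * mmap f h q.
Proof.
have mX m r : mmap f h ('X_[m] * r) = mmap1 h m * mmap f h r.
  rewrite [r]mpolyE mulr_sumr !raddf_sum mulr_sumr /=; apply: eq_bigr => m' _.
  rewrite -scalerAr -mpolyXD !mmapZ !mmapX mmap1M_commuting !mulrA.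
  by congr (_ * _); apply: fC.
rewrite {1 2}[p]mpolyE mulr_suml !raddf_sum mulr_suml /=; apply: eq_bigr => m _.
by rewrite -scalerAl !mmapZ mX mmapX mulrA.
Qed.

End Commuting.

(** * Commutators with products and with pairing sums *)

Section Derivation.
Variables (A : comNzRingType) (M : nzRingType) (phi : {additive A -> M}) (Y : M).
Hypotheses (phiM : {morph phi : x y / x * y}) (phi1 : phi 1 = 1).

(** Leibniz rule: commutation with [Y] is a derivation and [phi] is multiplicative. Since [r] has no
    duplicates, [z != y] drops exactly one factor. *)
Lemma commutator_prod_seq (T : eqType) (r : seq T) (X X' : T -> A) :
    uniq r -> (forall y, Y * phi (X y) - phi (X y) * Y = phi (X' y)) ->
  let p := \prod_(y <- r) X y in
  Y * phi p - phi p * Y = phi (\sum_(y <- r) X' y * \prod_(z <- r | z != y) X z).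
Proof.
move=> + hX; elim: r => [_|x r IHr /= /andP[xr ur]] /=.
  by rewrite !big_nil phi1 raddf0 mulr1 mul1r subrr.
rewrite !big_cons eqxx /= phiM mulrA -[phi (X x) * _ * Y]mulrA.
have -> : \prod_(z <- r | z != x) X z = \prod_(z <- r) X z.
  rewrite [LHS]big_seq_cond [RHS]big_seq; apply: eq_bigl => z.
  by case: (boolP (z \in r)) => //= zr; apply: contraNneq xr => <-.
have -> : \sum_(y <- r) X' y * \prod_(z <- x :: r | z != y) X z =
          X x * \sum_(y <- r) X' y * \prod_(z <- r | z != y) X z.
  rewrite mulr_sumr !big_seq; apply: eq_bigr => y yr; rewrite big_cons.
  have -> : x != y by apply: contraNneq xr => ->.
  by rewrite mulrCA.
rewrite raddfD /= !phiM -IHr // -hX mulrBl mulrBr !mulrA.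
by rewrite addrA subrK.
Qed.

Lemma commutator_prod (T : finType) (P : pred T) (X X' : T -> A) :
    (forall y, Y * phi (X y) - phi (X y) * Y = phi (X' y)) ->
  let p := \prod_(y | P y) X y in
  Y * phi p - phi p * Y = phi (\sum_(y | P y) X' y * \prod_(z | P z && (z != y)) X z).
Proof.
move=> hX /=; rewrite -[\prod_(y | P y) X y]big_filter.
rewrite (commutator_prod_seq (filter_uniq _ (index_enum_uniq _)) hX); congr (phi _).
by rewrite big_filter; apply: eq_bigr => y _; rewrite big_filter_cond.
Qed.

End Derivation.

Lemma subst_at_id N (T : Type) (I : 'I_N -> T) x j : subst_at I x j x = j.
Proof. by rewrite /subst_at eqxx. Qed.

Lemma subst_at_neq N (T : Type) (I : 'I_N -> T) x j y :
  y != x -> subst_at I x j y = I y.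
Proof. by rewrite /subst_at => /negbTE ->. Qed.

Lemma eq_Pk (C : numClosedFieldType) g k (I J : 'I_(k.*2) -> 'I_g) :
  I =1 J -> Pk C I = Pk C J.
Proof. by move=> IJ; apply: eq_bigr => s _; apply: eq_bigr => x _; rewrite !IJ. Qed.

(** By the Leibniz rule each pair of each pairing contributes two terms, one for each of its
    positions. Together the pairs run through all positions, and replacing the entry at one position
    alters only the factor of its pair. *)
Lemma commutator_Pk (C : numClosedFieldType) g (M : nzRingType)
    (phi : {additive {mpoly C[nvars g]} -> M}) (Y : M) (i j : 'I_g) k
    (I : 'I_(k.*2) -> 'I_g) :
    {morph phi : x y / x * y} -> phi 1 = 1 ->
    (forall u v, Y * phi (Lvar C u v) - phi (Lvar C u v) * Y =
      phi (Lvar C j v *+ (u == i) + Lvar C u j *+ (v == i))) ->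
  Y * phi (Pk C I) - phi (Pk C I) * Y =
    \sum_(x | I x == i) phi (Pk C (subst_at I x j)).
Proof.
move=> phiM phi1 hY; rewrite -raddf_sum /Pk exchange_big /=.
rewrite raddf_sum mulr_sumr mulr_suml -sumrB raddf_sum; apply: eq_bigr => s hs.
have [sK sN] := pairingP _ hs.
rewrite (commutator_prod phiM phi1 _ (X := fun x => Lvar C (I x) (I (s x)))
  (X' := fun x => Lvar C j (I (s x)) *+ (I x == i) + Lvar C (I x) j *+ (I (s x) == i)));
  last by move=> x; apply: hY.
congr (phi _); rewrite [RHS]big_mkcond (sum_pairing _ hs) /=; apply: eq_bigr => y ys.
have nsy (z : 'I_(k.*2)) : (z < s z)%N -> s z != y.
  by move=> zs; apply: contraTneq ys => <-; rewrite sK -leqNgt ltnW.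
have nzs (z : 'I_(k.*2)) : (z < s z)%N -> z != s y.
  by move=> zs; apply: contraTneq zs => ->; rewrite sK -leqNgt ltnW.
have prodE (x : 'I_(k.*2)) : x = y \/ x = s y ->
    \prod_(z : 'I_(k.*2) | (z < s z)%N) Lvar C (subst_at I x j z) (subst_at I x j (s z)) =
    Lvar C (subst_at I x j y) (subst_at I x j (s y)) *
    \prod_(z : 'I_(k.*2) | (z < s z)%N && (z != y)) Lvar C (I z) (I (s z)).
  move=> hx; rewrite (bigD1 y) //=; congr (_ * _); apply: eq_bigr => z /andP[zs zy].
  have szsy : s z != s y by rewrite (inj_eq perm_inj).
  by case: hx => ->; rewrite !subst_at_neq // ?nsy ?nzs.
rewrite !prodE; [|by right|by left].
rewrite !subst_at_id !subst_at_neq // 1?eq_sym // mulrDl !mulrnAl.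
by congr (_ + _); case: eqP.
Qed.

(* [Y] is a lowering operator: a pairing sum vanishing on the constant index
   vector [i] can be moved to any index vector one entry at a time. *)
Lemma Pk_vanish (C : numClosedFieldType) g (M : nzRingType)
    (phi : {additive {mpoly C[nvars g]} -> M}) (Y : 'I_g -> M) (i : 'I_g) k :
    (forall (r : nat) (x : M), x *+ r.+1 = 0 -> x = 0) ->
    {morph phi : x y / x * y} -> phi 1 = 1 ->
    (forall j u v, j != i -> Y j * phi (Lvar C u v) - phi (Lvar C u v) * Y j =
      phi (Lvar C j v *+ (u == i) + Lvar C u j *+ (v == i))) ->
    phi (Lvar C i i ^+ k) = 0 ->
  forall I : 'I_(k.*2) -> 'I_g, phi (Pk C I) = 0.
Proof.
move=> torsfree phiM phi1 hY phi0 I.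
have [r] := ubnP #|[pred x | I x != i]|; elim: r I => // r IHr I.
rewrite ltnS => leI; case: (pickP [pred x | I x != i]) => [x /= Ix|I0]; last first.
  rewrite /Pk raddf_sum big1 // => s hs.
  rewrite (eq_bigr (fun=> Lvar C i i)) => [|x _]; last first.
    by have /= /negbFE/eqP-> := I0 x; have /= /negbFE/eqP-> := I0 (s x).
  rewrite prodr_const -[phi _]/(phi (_ ^+ _)).
  by have /double_inj <- := card_pairing hs.
(* Restoring [i] at [x] leaves fewer wrong entries, so the induction kills [I']. The commutator of
   [Y (I x)] with it is therefore zero, while each of its terms is the pairing sum of a
   rearrangement of [I]. *)
pose I' := subst_at I x i.
have ltI : (#|[pred y | I' y != i]| < r)%N.
  apply: leq_trans leI; apply: proper_card; apply/properP; split.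
    apply/subsetP => y; rewrite !inE /I' /subst_at; case: ifP => //.
    by rewrite eqxx.
  by exists x; rewrite !inE /= ?Ix // /I' subst_at_id eqxx.
have swapI y : I' y = i -> subst_at I' y (I x) =1 I \o tperm x y.
  rewrite /I' /subst_at => + z; case: (eqVneq y x) => [->|yx] I'y /=.
    by rewrite tperm1 perm1; case: (eqVneq z x) => [->|].
  case: (eqVneq z y) => [->|zy]; first by rewrite tpermR.
  case: (eqVneq z x) => [->|zx]; first by rewrite tpermL I'y.
  by rewrite tpermD // eq_sym.
have := commutator_Pk I' phiM phi1 (fun u v => hY _ u v Ix).
rewrite IHr // mulr0 mul0r subrr (eq_bigr (fun=> phi (Pk C I))) => [|y /eqP I'y]; last first.
  by rewrite -(Pk_perm C I (tperm x y)); congr (phi _); apply: eq_Pk; apply: swapI.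
(* The position [x] is itself counted, so the multiplicity of [phi (Pk C I)] is positive. *)
rewrite sumr_const (cardD1 x).
have -> : (x \in [pred y | I' y == i]) by rewrite inE /I' subst_at_id.
by move/esym; apply: torsfree.
Qed.

(** * Graded operators with a highest weight *)

Section GradedAction.
Variables (C : numClosedFieldType) (m : nat) (a : nat).
Local Notation V := 'cV[C]_m.+1.
Local Notation End := 'M[C]_m.+1.
Variables (H : End) (Gr : int -> End -> Prop).
Hypothesis GrH : forall d T, Gr d T -> H *m T - T *m H = d%:~R *: T.
Hypothesis GrB : forall d e S T, Gr d S -> Gr e T -> Gr (d + e) (S *m T - T *m S).
Implicit Types (x y : V) (S T : End).

(* [layer k.+2] is the set of vectors of weight [a - k] killed by all products
   of positive-degree operators of total degree > [k]; the two zero layers at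
   the bottom absorb operators of degree 1 and 2. *)
Fixpoint layer (k : nat) (x : V) : Prop :=
  match k with
  | S k1 => match k1 with
    | S k0 => [/\ H *m x = (a%:Z - k0%:Z)%:~R *: x,
                 forall T, Gr 1 T -> layer k1 (T *m x) &
                 forall T, Gr 2 T -> layer k0 (T *m x)]
    | O => x = 0 end
  | O => x = 0 end.

Lemma layerSS k x : layer k.+2 x =
  [/\ H *m x = (a%:Z - k%:Z)%:~R *: x,
      forall T, Gr 1 T -> layer k.+1 (T *m x) &
      forall T, Gr 2 T -> layer k (T *m x)].
Proof. by []. Qed.

Lemma nat_two_step_ind (P : nat -> Prop) :
  P 0%N -> P 1%N -> (forall k, P k -> P k.+1 -> P k.+2) -> forall k, P k.
Proof.
move=> P0 P1 PS k; suff [] : P k /\ P k.+1 by [].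
by elim: k => [|k [Pk Pk1]]; split=> //; apply: PS.
Qed.

Lemma layer_linear k c x y : layer k x -> layer k y -> layer k (c *: x + y).
Proof.
elim/nat_two_step_ind: k c x y => [|| k IH0 IH1] c x y;
  try by move=> /= -> ->; rewrite scaler0 addr0.
rewrite !layerSS => -[Hx x1 x2] [Hy y1 y2]; split.
- by rewrite mulmxDr -scalemxAr Hx Hy scalerDr !scalerA mulrC.
- by move=> T GT; rewrite mulmxDr -scalemxAr; apply: IH1; auto.
by move=> T GT; rewrite mulmxDr -scalemxAr; apply: IH0; auto.
Qed.

Lemma layer0 k : layer k 0.
Proof.
elim/nat_two_step_ind: k => [|| k IH0 IH1] //; rewrite layerSS mulmx0 scaler0.
by split=> // T _; rewrite mulmx0.
Qed.

Lemma layerD k x y : layer k x -> layer k y -> layer k (x + y).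
Proof. by move=> kx ky; rewrite -[x]scale1r; apply: layer_linear. Qed.

Lemma weight_shift d T (c : int) x :
  Gr d T -> H *m x = c%:~R *: x -> H *m (T *m x) = (c + d)%:~R *: (T *m x).
Proof.
move=> /GrH GT Hx; rewrite mulmxA -[H *m T](subrK (T *m H)) GT mulmxDl.
by rewrite -mulmxA Hx -scalemxAl -scalemxAr -scalerDl addrC rmorphD.
Qed.

(** One scheme for the degrees 0, -1, -2, in this order. Raising [T x] by [S] gives [S T x = T S x +
    [S, T] x]: the first term falls under the induction on [k], and the bracket has the higher
    degree [1 - e] or [2 - e], already settled. *)
Lemma layer_lower_step (e : nat) :
    (forall k S x, Gr (1 - e%:Z) S -> layer k.+2 x -> layer (k + e).+1 (S *m x)) ->
    (forall k S x, Gr (2 - e%:Z) S -> layer k.+2 x -> layer (k + e) (S *m x)) ->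
  forall k T x, Gr (- e%:Z) T -> layer k x -> layer (k + e) (T *m x).
Proof.
move=> h1 h2; elim/nat_two_step_ind => [|| k IH0 IH1] T x GT.
- by move=> ->; rewrite mulmx0; apply: layer0.
- by move=> ->; rewrite mulmx0; apply: layer0.
move=> kx; rewrite !addSn layerSS; case: (kx) => Hx x1 x2.
have comm S : S *m (T *m x) = T *m (S *m x) + (S *m T - T *m S) *m x.
  by rewrite mulmxBl !mulmxA [RHS]addrC subrK.
split=> [|S GS|S GS].
- rewrite (weight_shift GT Hx); congr (_%:~R *: _).
  by rewrite PoszD opprD addrA.
- rewrite comm; apply: layerD; first by rewrite -addSn; apply: IH1 => //; apply: x1.
  exact: h1 (GrB GS GT) kx.
rewrite comm; apply: layerD; first by apply: IH0 => //; apply: x2.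
exact: h2 (GrB GS GT) kx.
Qed.

Lemma layer_deg0 k T x : Gr 0 T -> layer k x -> layer k (T *m x).
Proof.
rewrite -[in layer k (_ *m _)](addn0 k); apply: (@layer_lower_step 0).
  by move=> j S y; rewrite subr0 addn0 layerSS => GS [_ + _]; apply.
by move=> j S y; rewrite subr0 addn0 layerSS => GS [_ _]; apply.
Qed.

Lemma layer_degN1 k T x : Gr (-1) T -> layer k x -> layer k.+1 (T *m x).
Proof.
rewrite -[in layer k.+1]addn1; apply: (@layer_lower_step 1).
  by move=> j S y; rewrite addn1 subrr; apply: layer_deg0.
by move=> j S y; rewrite addn1 layerSS => GS [_ + _]; apply.
Qed.

Lemma layer_degN2 k T x : Gr (-2) T -> layer k x -> layer k.+2 (T *m x).
Proof.
rewrite -[in layer k.+2]addn2; apply: (@layer_lower_step 2).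
  by move=> j S y; rewrite addn2; apply: layer_degN1.
by move=> j S y; rewrite addn2 subrr; apply: layer_deg0.
Qed.

Lemma layer_deg1 k T x : Gr 1 T -> layer k x -> layer k.-1 (T *m x).
Proof.
by case: k => [|[|k]] GT; [move=> ->; rewrite mulmx0..|rewrite layerSS => -[_ + _]; apply].
Qed.

Lemma layer_deg2 k T x : Gr 2 T -> layer k x -> layer k.-2 (T *m x).
Proof.
by case: k => [|[|k]] GT; [move=> ->; rewrite mulmx0..|rewrite layerSS => -[_ _]; apply].
Qed.

(** The span of all layers, as a predicate. It is stable under the operators of degree -2 to 2, so
    irreducibility will make it the whole space. *)
Inductive layer_sum : V -> Prop :=
| LayerSum0 : layer_sum 0
| LayerSumD k x y : layer k x -> layer_sum y -> layer_sum (x + y).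

Lemma layer_sum1 k x : layer k x -> layer_sum x.
Proof. by move=> kx; rewrite -[x]addr0; apply: LayerSumD kx LayerSum0. Qed.

Lemma layer_sum_linear c x y : layer_sum x -> layer_sum y -> layer_sum (c *: x + y).
Proof.
move=> sx sy; elim: sx => [|k u v ku _ IH]; first by rewrite scaler0 add0r.
rewrite scalerDr -addrA; apply: LayerSumD IH.
by rewrite -[c *: u]addr0; apply: layer_linear ku (layer0 k).
Qed.

Lemma layer_sum_Gr (d : int) T x :
  d \in [:: -2; -1; 0; 1; 2] -> Gr d T -> layer_sum x -> layer_sum (T *m x).
Proof.
move=> hd GT; elim=> [|k u v ku _ IH]; first by rewrite mulmx0; apply: LayerSum0.
rewrite mulmxDr -[T *m u]scale1r; apply: layer_sum_linear => //.
move: hd GT; rewrite !inE => /or4P[/eqP->|/eqP->|/eqP->|/orP[]/eqP->] GT; apply: layer_sum1.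
- exact: layer_degN2 GT ku.
- exact: layer_degN1 GT ku.
- exact: layer_deg0 GT ku.
- exact: layer_deg1 GT ku.
- exact: layer_deg2 GT ku.
Qed.

(** * An sl_2-triple and the lower bound on weights *)

Variables (E F : End).
Hypotheses (GrE : Gr 2 E) (GrF : Gr (-2) F) (EF : E *m F - F *m E = H).

(** The subtraction truncates: when it gives 0 or 1 the layer is zero, so high powers of [E] vanish
    on each layer. *)
Lemma layer_exprE j k x : layer k x -> layer (k - j.*2) (E ^+ j *m x).
Proof.
move=> kx; elim: j => [|j IH]; first by rewrite expr0 mul1mx subn0.
rewrite exprS -mulmxA doubleS subnS subnS; exact: layer_deg2.
Qed.

Lemma layer_exprF j k x : layer k x -> layer (k + j.*2) (F ^+ j *m x).
Proof.
move=> kx; elim: j => [|j IH]; first by rewrite expr0 mul1mx addn0.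
rewrite exprS -mulmxA doubleS !addnS; exact: layer_degN2.
Qed.

Lemma weight_exprE j (c : int) x :
  H *m x = c%:~R *: x -> H *m (E ^+ j *m x) = (c + j.*2%:Z)%:~R *: (E ^+ j *m x).
Proof.
move=> Hx; elim: j => [|j IH]; first by rewrite expr0 mul1mx addr0.
rewrite exprS -mulmxA (weight_shift GrE IH); congr (_%:~R *: _); lia.
Qed.

(** The sl_2 computation at a lowest-weight vector of weight [- p], moving [F] past one [E] at a
    time. The coefficient is nonzero for [j < p]. *)
Lemma mulF_exprE (p j : nat) x : H *m x = (- p%:Z)%:~R *: x -> F *m x = 0 ->
  F *m (E ^+ j.+1 *m x) = (j.+1%:Z * (p%:Z - j%:Z))%:~R *: (E ^+ j *m x).
Proof.
move=> Hx Fx.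
have FE y : F *m (E *m y) = E *m (F *m y) - H *m y.
  by rewrite -EF mulmxBl !mulmxA opprB addrC subrK.
elim: j => [|j IH].
  by rewrite expr1 FE Fx mulmx0 sub0r Hx expr0 mul1mx -scaleNr -rmorphN; congr (_%:~R *: _); lia.
rewrite exprS -mulmxA FE IH -scalemxAr [E *m _]mulmxA -[E *m E ^+ j]/(E * E ^+ j).
rewrite -exprS (weight_exprE _ Hx).
by rewrite -scalerBl -rmorphB; congr (_%:~R *: _); lia.
Qed.

(** The weight of [x] is [- p] with [p = k - a > a]. Then [E ^+ p] would raise [x] to weight
    [p > a], so it kills [x]; applying [F] repeatedly to this relation strips off one [E] at a time,
    the coefficients being nonzero. *)
Lemma layer_lowest0 k x : layer k.+2 x -> (a.*2 < k)%N -> F *m x = 0 -> x = 0.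
Proof.
move=> kx ak Fx; case: (kx) => Hx _ _; pose p := (k - a)%N.
have Hp : H *m x = (- p%:Z)%:~R *: x by rewrite Hx; congr (_%:~R *: _); lia.
suff E0 i : (i <= p)%N -> E ^+ (p - i) *m x = 0.
  by have := E0 p (leqnn p); rewrite subnn expr0 mul1mx.
elim: i => [_|i IH ip].
  have := layer_exprE p kx; rewrite subn0.
  have : (k.+2 - p.*2 < 2)%N by lia.
  by case: (k.+2 - p.*2)%N => [|[|]].
have := mulF_exprE (p - i.+1) Hp Fx.
rewrite -subSn // subSS IH ?mulmx0; last exact: ltnW.
move/esym/eqP; rewrite scaler_eq0 intr_eq0 => /orP[|/eqP //].
by rewrite mulf_eq0 => /orP[]/eqP; lia.
Qed.

(** Otherwise the vectors [F ^+ r *m x] are eigenvectors of [H] with infinitely many distinct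
    eigenvalues, too many for a matrix of size [m.+1]. *)
Lemma layer_exprF_eq0 k x : layer k.+2 x -> exists r, F ^+ r *m x = 0.
Proof.
move=> kx; apply: NNPP => nF.
have Fn0 r : F ^+ r *m x != 0 by apply/eqP => Fr; apply: nF; exists r.
pose w (r : nat) : C := (a%:Z - (k + r.*2)%:Z)%:~R.
have rw r : root (char_poly H^T) (w r).
  rewrite -eigenvalue_root_char; apply/eigenvalueP; exists (F ^+ r *m x)^T; last first.
    by rewrite -trmx0 (inj_eq trmx_inj).
  by rewrite -trmx_mul -linearZ /=; case: (layer_exprF r kx) => ->.
have := max_poly_roots (monic_neq0 (char_poly_monic H^T)) (rs := map w (iota 0 m.+2)).
rewrite size_char_poly size_map size_iota ltnn => h.
suff: false by []; apply: h.
  by apply/allP => _ /mapP[r _ ->].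
rewrite map_inj_uniq ?iota_uniq // => r s /eqP.
by rewrite /w eqr_int => /eqP; lia.
Qed.

(** Induction on the power of [F] killing [x]: the vector [F x] lies in a still lower layer, so it
    vanishes, and [x] is a lowest-weight vector. *)
Lemma layer_low0 k x : layer k.+2 x -> (a.*2 < k)%N -> x = 0.
Proof.
move=> kx ak; have [r] := layer_exprF_eq0 kx.
elim: r k x kx ak => [|r IHr] k x kx ak; first by rewrite expr0 mul1mx.
rewrite exprSr -mulmxA => Fr; apply: (layer_lowest0 kx ak).
by apply: IHr Fr; [exact: (layer_degN2 GrF kx) | lia].
Qed.

Lemma layer_sum_expr0 n x : (a <= n)%N -> layer_sum x -> E ^+ n.+1 *m x = 0.
Proof.
move=> an; elim=> [|k u v ku _ IH]; first exact: mulmx0.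
rewrite mulmxDr IH addr0; case: k ku => [|[|k]] ku; try by rewrite [u]ku mulmx0.
have [ak|ka] := ltnP a.*2 k; first by rewrite (layer_low0 ku ak) mulmx0.
(* Now [k <= 2a <= 2n], so [E ^+ n.+1] lands in [layer 0]. *)
have := layer_exprE n.+1 ku.
by have -> : (k.+2 - n.+1.*2)%N = 0%N by lia.
Qed.

End GradedAction.

(** * The grading of sp(g) *)

Section Sp.
Variables (C : numClosedFieldType) (g : nat).
Implicit Types (X Y : 'M[C]_(g + g)) (i j : 'I_g).

Lemma is_spP X : is_sp X <->
  [/\ forall i j, X (rshift g i) (rshift g j) = - X (lshift g j) (lshift g i),
      forall i j, X (lshift g i) (rshift g j) = X (lshift g j) (rshift g i) &
      forall i j, X (rshift g i) (lshift g j) = X (rshift g j) (lshift g i)].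
Proof.
split=> [[a [b [c [-> [bT cT]]]]]|[hd hb hc]].
  split=> i j; rewrite ?block_mxEdr ?block_mxEul ?block_mxEur ?block_mxEdl ?mxE //.
    by rewrite -[in LHS]bT mxE.
  by rewrite -[in LHS]cT mxE.
exists (ulsubmx X), (ursubmx X), (dlsubmx X).
split; last by split; apply/matrixP => i j; rewrite !mxE.
rewrite -{1}[X]submxK; congr (block_mx _ _ _ _).
by apply/matrixP => i j; rewrite !mxE hd.
Qed.

Lemma is_sp0 : is_sp (0 : 'M[C]_(g + g)).
Proof. by apply/is_spP; split=> i j; rewrite !mxE ?oppr0. Qed.

Lemma is_sp_linear k X Y : is_sp X -> is_sp Y -> is_sp (k *: X + Y).
Proof.
move=> /is_spP[Xd Xb Xc] /is_spP[Yd Yb Yc]; apply/is_spP; split=> i j; rewrite !mxE.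
- by rewrite Xd Yd mulrN opprD.
- by rewrite Xb Yb.
by rewrite Xc Yc.
Qed.

Lemma is_spZ k X : is_sp X -> is_sp (k *: X).
Proof. by move=> hX; rewrite -[_ *: _]addr0; apply: is_sp_linear hX is_sp0. Qed.

Lemma is_spD X Y : is_sp X -> is_sp Y -> is_sp (X + Y).
Proof. by move=> hX; rewrite -[X]scale1r; apply: is_sp_linear. Qed.

Lemma is_sp_sum (T : Type) (r : seq T) (P : pred T) (X : T -> 'M[C]_(g + g)) :
  (forall t, P t -> is_sp (X t)) -> is_sp (\sum_(t <- r | P t) X t).
Proof. by move=> hX; elim/big_ind: _ => //; [apply: is_sp0 | apply: is_spD]. Qed.

Lemma is_sp_bracket X Y : is_sp X -> is_sp Y -> is_sp (X *m Y - Y *m X).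
Proof.
move=> [a [b [c [-> [bT cT]]]]] [a' [b' [c' [-> [b'T c'T]]]]].
exists (a *m a' + b *m c' - (a' *m a + b' *m c)).
exists (a *m b' - b *m a'^T - (a' *m b - b' *m a^T)).
exists (c *m a' - a^T *m c' - (c' *m a - a'^T *m c)).
split; last first.
  split; rewrite !linearB /= !trmx_mul ?trmxK ?bT ?cT ?b'T ?c'T.
    by rewrite !opprK [LHS](AC (2*2) ((4*3)*(2*1)))%AC.
  by rewrite !opprK [LHS](AC (2*2) ((4*3)*(2*1)))%AC.
rewrite !mulmx_block opp_block_mx add_block_mx; congr (block_mx _ _ _ _).
- by rewrite !mulmxN.
- by rewrite !mulNmx.
rewrite !linearB /= !linearD /= !trmx_mul bT cT b'T c'T !mulmxN !mulNmx !opprK.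
by rewrite [LHS](AC (2*2) ((4*3)*(2*1)))%AC.
Qed.

Lemma is_sp_diag_block (a : 'M[C]_g) : is_sp (block_mx a 0 0 (- a^T)).
Proof. by exists a, 0, 0; rewrite !trmx0. Qed.

Lemma is_sp_upper_block (b : 'M[C]_g) : b^T = b -> is_sp (block_mx 0 b 0 0).
Proof. by exists 0, b, 0; rewrite !trmx0 oppr0. Qed.

Lemma is_sp_cartan (d : 'rV[C]_g) : is_sp (cartan_elt d).
Proof. by rewrite /cartan_elt -{2}[diag_mx d]tr_diag_mx; apply: is_sp_diag_block. Qed.

Lemma is_sp_root_A i j : is_sp (root_vec_A C i j).
Proof. exact: is_sp_diag_block. Qed.

Lemma is_sp_Lmat i j : is_sp (Lmat C i j).
Proof. by apply: is_sp_upper_block; rewrite linearZ linearD /= !trmx_delta addrC. Qed.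

(** Root vector of [-2 eps_i]: with [E = Lmat C i i] and [H = cartan_elt (delta_mx 0 i)] it is the
    [F] of an sl_2-triple. *)
Definition root_vec_C i : 'M[C]_(g + g) := block_mx 0 0 (delta_mx i i) 0.

Lemma is_sp_root_C i : is_sp (root_vec_C i).
Proof. by exists 0, 0, (delta_mx i i); rewrite trmx_delta !trmx0 oppr0. Qed.

Lemma LmatC i j : Lmat C i j = Lmat C j i.
Proof. by rewrite /Lmat addrC. Qed.

Lemma Lmat_mul0 i j u v : Lmat C i j *m Lmat C u v = 0.
Proof. by rewrite mulmx_block !mul0mx !mulmx0 !addr0 block_mx_const. Qed.

Lemma Lmat_diag i : Lmat C i i = block_mx 0 (delta_mx i i) 0 0.
Proof. by rewrite /Lmat -mulr2n -scaler_nat scalerA mulVf ?scale1r ?pnatr_eq0. Qed.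

(** The subalgebra gl(g) acts on [S^2 W] by derivations, and [root_vec_A C j i] sends [e_i] to [e_j]
    and the other basis vectors of [W] to zero. *)
Lemma bracket_root_A_Lmat i j u v :
  root_vec_A C j i *m Lmat C u v - Lmat C u v *m root_vec_A C j i =
  Lmat C j v *+ (u == i) + Lmat C u j *+ (v == i).
Proof.
rewrite /root_vec_A /Lmat !mulmx_block !mul0mx !mulmx0 !addr0 !add0r.
rewrite opp_block_mx !add_block_mx !oppr0 !addr0 mulmxN opprK trmx_delta.
rewrite -scalemxAr -scalemxAl mulmxDr mulmxDl !mul_delta_mx_cond.
rewrite ![i == _]eq_sym; case: (u == i); case: (v == i);
  rewrite ?mulr0n ?mulr1n ?add_block_mx ?scaler0 -?scalerDr ?addr0 ?add0r //=.
- by rewrite [in LHS](AC (2*2) ((1*4)*(3*2)))%AC.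
- by rewrite [in LHS]addrC.
by rewrite scaler0 block_mx_const.
Qed.

Lemma bracket_EF i :
  Lmat C i i *m root_vec_C i - root_vec_C i *m Lmat C i i = cartan_elt (delta_mx 0 i).
Proof.
rewrite Lmat_diag /root_vec_C !mulmx_block !mul0mx !mulmx0 !addr0 !add0r.
rewrite opp_block_mx add_block_mx !oppr0 !addr0 add0r mul_delta_mx /cartan_elt.
have -> : diag_mx (delta_mx 0 i) = delta_mx i i :> 'M[C]_g.
  apply/matrixP => u v; rewrite !mxE eqxx /=.
  case: (eqVneq u v) => [->|uv]; rewrite ?andbb //.
  by case: (eqVneq u i) uv => //= ->; rewrite eq_sym => /negbTE ->.
by [].
Qed.

Section Grading.
Variable i0 : 'I_g.

(** The diagonal entries of [cartan_elt (delta_mx 0 i0)] as integers; under its adjoint action the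
    matrix entry at [(x, y)] has degree [wt x - wt y]. *)
Definition wt (x : 'I_(g + g)) : int :=
  match split x with inl i => (i == i0)%:Z | inr i => - (i == i0)%:Z end.

Lemma wt_lshift i : wt (lshift g i) = (i == i0)%:Z.
Proof. by rewrite /wt -[lshift g i]/(unsplit (inl i)) unsplitK. Qed.

Lemma wt_rshift i : wt (rshift g i) = - (i == i0)%:Z.
Proof. by rewrite /wt -[rshift g i]/(unsplit (inr i)) unsplitK. Qed.

Lemma cartan_bracketE X x y :
  (cartan_elt (delta_mx 0 i0) *m X - X *m cartan_elt (delta_mx 0 i0)) x y =
  (wt x - wt y)%:~R * X x y.
Proof.
pose D : 'rV[C]_(g + g) := \row_x (wt x)%:~R.
have -> : cartan_elt (delta_mx 0 i0) = diag_mx D.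
  rewrite /cartan_elt -linearN /= -diag_mx_row; congr diag_mx.
  apply/rowP => z; rewrite !mxE /wt.
  by case: (split z) => i; rewrite !mxE !eqxx /= ?rmorphN.
by rewrite mul_diag_mx mul_mx_diag !mxE rmorphB mulrBl [X in _ - X]mulrC.
Qed.

Definition sp_deg (d : int) X : Prop :=
  is_sp X /\
  cartan_elt (delta_mx 0 i0) *m X - X *m cartan_elt (delta_mx 0 i0) = d%:~R *: X.

Lemma sp_deg_supp d X x y : sp_deg d X -> wt x - wt y != d -> X x y = 0.
Proof.
move=> [_ hX] ne; apply/eqP; move: (cartan_bracketE X x y); rewrite hX mxE => /eqP.
rewrite -subr_eq0 -mulrBl -rmorphB mulf_eq0 intr_eq0 subr_eq0 eq_sym.
by rewrite (negbTE ne).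
Qed.

Definition sp_component (d : int) X : 'M[C]_(g + g) :=
  \matrix_(x, y) (X x y *+ (wt x - wt y == d)).

Lemma sp_component_deg d X : is_sp X -> sp_deg d (sp_component d X).
Proof.
move=> /is_spP[hd hb hc]; split; last first.
  apply/matrixP => x y; rewrite cartan_bracketE !mxE.
  by case: eqP => [->|] //=; rewrite !mulr0n !mulr0.
apply/is_spP; split=> i j; rewrite !mxE !wt_lshift !wt_rshift.
- by rewrite hd mulNrn opprK addrC.
- by rewrite hb !opprK addrC.
by rewrite hc addrC.
Qed.

Lemma sum_sp_component X : X = \sum_(d <- [:: -2; -1; 0; 1; 2]) sp_component d X.
Proof.
apply/matrixP => x y; rewrite !big_cons big_nil !mxE addr0.
have wtE z : [\/ wt z = 0, wt z = 1 | wt z = -1].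
  by rewrite /wt; case: (split z) => i; case: (i == i0);
    [constructor 2|constructor 1|constructor 3|constructor 1].
by case: (wtE x) => ->; case: (wtE y) => -> /=; rewrite ?mulr0n ?mulr1n ?addr0 ?add0r.
Qed.

Lemma sp_deg_bracket d e X Y :
  sp_deg d X -> sp_deg e Y -> sp_deg (d + e) (X *m Y - Y *m X).
Proof.
move=> [sX hX] [sY hY]; split; first exact: is_sp_bracket.
set h := cartan_elt _ in hX hY *.
have {}hX : h *m X = X *m h + d%:~R *: X by rewrite -hX addrC subrK.
have {}hY : h *m Y = Y *m h + e%:~R *: Y by rewrite -hY addrC subrK.
have hM (p q : int) U V : h *m U = U *m h + p%:~R *: U -> h *m V = V *m h + q%:~R *: V ->
    h *m (U *m V) = (U *m V) *m h + (p + q)%:~R *: (U *m V).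
  move=> hU hV; rewrite mulmxA hU mulmxDl -mulmxA hV mulmxDr mulmxA -addrA.
  by rewrite -scalemxAl -scalemxAr -scalerDl -rmorphD [q + p]addrC.
rewrite mulmxBr mulmxBl (hM _ _ _ _ hX hY) (hM _ _ _ _ hY hX) [e + d]addrC.
rewrite scalerBr opprB opprD [LHS](AC (2*2*2) (((1*6)*(3*5))*(2*4)))%AC.
by rewrite /= subrr addNr !add0r.
Qed.

Lemma sp_deg_E : sp_deg 2 (Lmat C i0 i0).
Proof.
split; first exact: is_sp_Lmat.
apply/matrixP => x y; rewrite cartan_bracketE [RHS]mxE Lmat_diag.
case: (split_ordP x) => u ->; case: (split_ordP y) => v ->; rewrite ?wt_lshift ?wt_rshift;
  rewrite ?block_mxEul ?block_mxEur ?block_mxEdl ?block_mxEdr !mxE ?mulr0 //.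
by case: eqP => // _; case: eqP => // _; rewrite !mulr0.
Qed.

Lemma sp_deg_F : sp_deg (-2) (root_vec_C i0).
Proof.
split; first exact: is_sp_root_C.
apply/matrixP => x y; rewrite cartan_bracketE [RHS]mxE /root_vec_C.
case: (split_ordP x) => u ->; case: (split_ordP y) => v ->; rewrite ?wt_lshift ?wt_rshift;
  rewrite ?block_mxEul ?block_mxEur ?block_mxEdl ?block_mxEdr !mxE ?mulr0 //.
by case: eqP => // _; case: eqP => // _; rewrite !mulr0.
Qed.

End Grading.
End Sp.

(** * Subspaces as predicates, and reduction to elementary matrices *)

(** [U] is enlarged by vectors of [P] outside it until none is left; the codimension [n - \rank U]
    drops each time. This turns [layer_sum] into a matrix to which irreducibility applies. *)
Lemma span_pred (F : fieldType) n (P : 'rV[F]_n -> Prop) :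
    P 0 -> (forall c u w, P u -> P w -> P (c *: u + w)) ->
  exists U : 'M[F]_n, forall u, (u <= U)%MS <-> P u.
Proof.
move=> P0 PL.
suff main k (U : 'M[F]_n) : (n - \rank U <= k)%N -> (forall u, (u <= U)%MS -> P u) ->
    exists U' : 'M[F]_n, forall u, (u <= U')%MS <-> P u.
  by apply: (main n 0) => [|u]; [exact: leq_subr | rewrite submx0 => /eqP->].
elim: k U => [|k IHk] U rU UP.
  have fU : row_full U by rewrite /row_full eqn_leq rank_leq_col -subn_eq0 -leqn0.
  by exists U => u; split=> [/UP //|_]; apply: submx_full.
case: (classic (exists2 u, P u & ~~ (u <= U)%MS)) => [[u Pu uU]|nU]; last first.
  exists U => u; split=> [/UP //|Pu]; apply/negPn/negP => uU; apply: nU; by exists u.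
apply: (IHk (U + u)%MS) => [|w /sub_addsmxP[[w1 w2] /= ->]].
  have : (U < U + u)%MS by rewrite ltmxE addsmxSl addsmx_sub submx_refl.
  rewrite ltmxErank addsmxSl /= => ltr; rewrite leq_subLR.
  by move: rU ltr; lia.
have -> : w2 *m u = w2 0 0 *: u by rewrite [w2]mx11_scalar mul_scalar_mx mxE eqxx.
by rewrite addrC; apply: PL => //; apply: UP; apply: submxMl.
Qed.

Lemma mx_delta_ind (R : pzSemiRingType) p q (P : 'M[R]_(p, q) -> Prop) (M : 'M[R]_(p, q)) :
    P 0 -> (forall X Y, P X -> P Y -> P (X + Y)) ->
    (forall i j, P (M i j *: delta_mx i j)) -> P M.
Proof.
move=> P0 PD Pd; rewrite [M]matrix_sum_delta.
by do 2![apply: (big_ind P) => // ? _].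
Qed.

Lemma diag_blockD (R : pzRingType) g (x y : 'M[R]_g) :
  block_mx (x + y) 0 0 (- (x + y)^T) = block_mx x 0 0 (- x^T) + block_mx y 0 0 (- y^T).
Proof. by rewrite add_block_mx !addr0 linearD opprD. Qed.

Lemma diag_blockZ (R : comPzRingType) g k (x : 'M[R]_g) :
  block_mx (k *: x) 0 0 (- (k *: x)^T) = k *: block_mx x 0 0 (- x^T).
Proof. by rewrite scale_block_mx !scaler0 linearZ scalerN. Qed.

Lemma upper_blockD (R : pzRingType) g (x y : 'M[R]_g) :
  block_mx 0 (x + y + (x + y)^T) 0 0 =
  block_mx 0 (x + x^T) 0 0 + block_mx 0 (y + y^T) 0 0 :> 'M_(g + g).
Proof. by rewrite add_block_mx !addr0 linearD addrACA. Qed.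

Lemma upper_blockZ (R : comPzRingType) g k (x : 'M[R]_g) :
  block_mx 0 (k *: x + (k *: x)^T) 0 0 = k *: block_mx 0 (x + x^T) 0 0 :> 'M_(g + g).
Proof. by rewrite scale_block_mx !scaler0 linearZ scalerDr. Qed.

(** * Irreducible representations *)

Section Representation.
Variables (C : numClosedFieldType) (g m : nat) (rho : 'M[C]_(g + g) -> 'M[C]_m.+1).
Hypothesis hrep : is_sp_rep rho.

Lemma rep_linear k X Y : is_sp X -> is_sp Y -> rho (k *: X + Y) = k *: rho X + rho Y.
Proof. by case: hrep => h _; apply: h. Qed.

Lemma rep_bracket X Y : is_sp X -> is_sp Y ->
  rho X *m rho Y - rho Y *m rho X = rho (X *m Y - Y *m X).
Proof. by case: hrep => _ h ? ?; rewrite h. Qed.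

Lemma repD X Y : is_sp X -> is_sp Y -> rho (X + Y) = rho X + rho Y.
Proof. by move=> hX hY; rewrite -{1}[X]scale1r rep_linear // scale1r. Qed.

Lemma rep0 : rho 0 = 0.
Proof.
have /eqP := repD (is_sp0 C g) (is_sp0 C g).
by rewrite addr0 -subr_eq0 opprD addrA subrr sub0r oppr_eq0 => /eqP.
Qed.

Lemma repZ k X : is_sp X -> rho (k *: X) = k *: rho X.
Proof. by move=> hX; rewrite -[k *: X]addr0 rep_linear ?rep0 ?addr0 //; apply: is_sp0. Qed.

Lemma rep_sum (T : Type) (r : seq T) (X : T -> 'M[C]_(g + g)) :
  (forall t, is_sp (X t)) -> rho (\sum_(t <- r) X t) = \sum_(t <- r) rho (X t).
Proof.
move=> hX; elim: r => [|t r IHr]; first by rewrite !big_nil rep0.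
by rewrite !big_cons repD ?IHr //; apply: is_sp_sum.
Qed.

Variables (i0 : 'I_g) (v : 'cV[C]_m.+1).
Hypothesis i0_min : forall i, (i0 <= i)%N.

(** The hypotheses place [X] in the nilradical of the Borel subalgebra, the span of the positive
    root vectors, each of which kills [v]. *)
Lemma rep_upper_kill (X : 'M[C]_(g + g)) :
    (forall i j : 'I_g, (i < j)%N -> rho (root_vec_A C i j) *m v = 0) ->
    (forall i j : 'I_g, (i <= j)%N -> rho (root_vec_B C i j) *m v = 0) ->
    is_sp X ->
    (forall i j : 'I_g, (j <= i)%N -> X (lshift g i) (lshift g j) = 0) ->
    (forall i j, X (rshift g i) (lshift g j) = 0) ->
  rho X *m v = 0.
Proof.
move=> hA hB [a [b [c [-> [bT cT]]]]] hl hr.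
have -> : c = 0 by apply/matrixP => i j; have := hr i j; rewrite block_mxEdl mxE.
(* The symmetric block is written as [u + u^T] with [u] half of [b], because [u = delta_mx i j] then
   gives exactly [root_vec_B]. *)
have -> : block_mx a b 0 (- a^T) =
    block_mx a 0 0 (- a^T) + block_mx 0 (2^-1 *: b + (2^-1 *: b)^T) 0 0.
  have half : 2^-1 + 2^-1 = 1 :> C by rewrite [RHS]splitr mul1r.
  by rewrite add_block_mx !addr0 !add0r linearZ /= bT -scalerDl half scale1r.
have spA (u : 'M[C]_g) := is_sp_diag_block u.
have spB (u : 'M[C]_g) : is_sp (block_mx 0 (u + u^T) 0 0).
  by apply: is_sp_upper_block; rewrite linearD /= trmxK addrC.
rewrite repD // mulmxDl.
have -> : rho (block_mx a 0 0 (- a^T)) *m v = 0.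
  apply: (mx_delta_ind (P := fun u => rho (block_mx u 0 0 (- u^T)) *m v = 0)).
  - by rewrite trmx0 oppr0 block_mx_const rep0 mul0mx.
  - by move=> x y hx hy; rewrite diag_blockD repD // mulmxDl hx hy addr0.
  move=> i j; rewrite diag_blockZ repZ // -scalemxAl.
  case: (ltnP i j) => ij; first by rewrite hA // scaler0.
  by have := hl i j ij; rewrite block_mxEul => ->; rewrite scale0r.
rewrite add0r; move: (2^-1 *: b) => b'.
apply: (mx_delta_ind (P := fun u => rho (block_mx 0 (u + u^T) 0 0) *m v = 0)).
- by rewrite trmx0 addr0 block_mx_const rep0 mul0mx.
- by move=> x y hx hy; rewrite upper_blockD repD // mulmxDl hx hy addr0.
move=> i j; rewrite upper_blockZ repZ // -scalemxAl trmx_delta.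
case: (leqP i j) => ij; first by rewrite hB // scaler0.
by rewrite addrC hB ?scaler0 // ltnW.
Qed.

Definition rep_deg (d : int) (T : 'M[C]_m.+1) : Prop := exists2 X, sp_deg i0 d X & T = rho X.

Local Notation H := (rho (cartan_elt (delta_mx 0 i0))).

Lemma rep_deg_bracketH d T : rep_deg d T -> H *m T - T *m H = d%:~R *: T.
Proof.
case=> X [sX hX] ->; rewrite rep_bracket //; last exact: is_sp_cartan.
by rewrite hX repZ.
Qed.

Lemma rep_deg_bracket d e S T :
  rep_deg d S -> rep_deg e T -> rep_deg (d + e) (S *m T - T *m S).
Proof.
move=> [X hX ->] [Y hY ->]; exists (X *m Y - Y *m X); first exact: sp_deg_bracket.
by rewrite rep_bracket; [|case: hX|case: hY].
Qed.

Lemma layer_sum_rep a X x :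
  is_sp X -> layer_sum a H rep_deg x -> layer_sum a H rep_deg (rho X *m x).
Proof.
move=> hX sx; rewrite [X](sum_sp_component i0) rep_sum => [|d]; last first.
  by case: (sp_component_deg i0 d hX).
rewrite mulmx_suml big_seq; elim/big_ind: _ => [|y z sy sz|d dl].
- exact: LayerSum0.
- by rewrite -[y]scale1r; apply: layer_sum_linear.
apply: (layer_sum_Gr rep_deg_bracketH rep_deg_bracket dl) => //.
by exists (sp_component i0 d X) => //; apply: sp_component_deg.
Qed.

(** As [i0] is the first index, an element of positive degree is a combination of positive root
    vectors and kills [v]. Layer 2 is the layer of weight [a i0], the indices being shifted by
    two. *)
Lemma highest_layer (a : 'I_g -> nat) :
    (forall d : 'rV[C]_g, rho (cartan_elt d) *m v = (\sum_i (a i)%:R * d 0 i) *: v) ->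
    (forall i j : 'I_g, (i < j)%N -> rho (root_vec_A C i j) *m v = 0) ->
    (forall i j : 'I_g, (i <= j)%N -> rho (root_vec_B C i j) *m v = 0) ->
  layer (a i0) H rep_deg 2 v.
Proof.
move=> hH hA hB.
have kill d T : (0 < d)%R -> rep_deg d T -> T *m v = 0.
  move=> d0 [X hX ->]; have [sX _] := hX.
  apply: rep_upper_kill => // i j => [ji|]; apply: (sp_deg_supp hX);
    rewrite ?wt_lshift ?wt_rshift.
    apply: contraTneq d0 => <-; case: (eqVneq i i0) ji => [->|_ _]; last by lia.
    by move=> ji; have -> : j = i0 by [apply/val_inj/eqP; rewrite eqn_leq ji i0_min]; rewrite eqxx.
  by apply: contraTneq d0 => <-; lia.
rewrite layerSS; split=> [|T /kill->|T /kill->] //.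
rewrite hH subr0 (bigD1 i0) //= mxE !eqxx mulr1 big1 ?addr0 // => i ne.
by rewrite mxE (negbTE ne) andbF mulr0.
Qed.

(** The span of the layers is a stable subspace containing [v], hence everything. Transposes pass
    between column vectors and the row spaces encoding subspaces. *)
Lemma irreducible_layer_sum a :
  is_irreducible_rep rho -> v != 0 -> layer a H rep_deg 2 v ->
  forall x, layer_sum a H rep_deg x.
Proof.
move=> hirr v0 hv x.
have [|c u w|U hU] := @span_pred C m.+1 (fun u => layer_sum a H rep_deg u^T).
- by rewrite trmx0; apply: LayerSum0.
- by rewrite linearD linearZ; apply: layer_sum_linear.
have hUX X : is_sp X -> (U *m (rho X)^T <= U)%MS.
  move=> hX; apply/row_subP => i; rewrite row_mul; apply/hU.
  by rewrite trmx_mul trmxK; apply: layer_sum_rep => //; apply/hU/row_sub.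
case: (hirr U hUX) => [U0|fU].
  have /hU : layer_sum a H rep_deg v^T^T by rewrite trmxK; apply: layer_sum1 hv.
  by rewrite U0 submx0 => /eqP vT; rewrite -[v]trmxK vT trmx0 eqxx in v0.
by rewrite -[x]trmxK; apply/hU/submx_full.
Qed.

End Representation.

(** * Annihilation of the representation by the ideal *)

Theorem theorem4 (C : numClosedFieldType) (n g m : nat) (hg : (0 < g)%N)
    (rho : 'M[C]_(g + g) -> 'M[C]_(m.+1)) (a : 'I_g -> nat)
    (hrep : is_sp_rep rho) (hirr : is_irreducible_rep rho)
    (hdom : forall i j : 'I_g, (i <= j)%N -> (a j <= a i)%N)
    (hn : forall i : 'I_g, (a i <= n)%N)
    (hw : is_highest_weight rho a) :
  forall p : {mpoly C[nvars g]}, @in_ideal_Pk C g n.+1 p -> act_S rho p = 0.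
Proof.
move=> p [K [q [I [_ ->]]]].
pose i0 := Ordinal hg; have i0_min i : (i0 <= i)%N by [].
pose L (t : 'I_(nvars g)) := rho (Lmat C (enum_val t).1 (enum_val t).2).
pose phi : {additive {mpoly C[nvars g]} -> 'M[C]_m.+1} := mmap (@scalar_mx C m.+1) L.
have LC s t : GRing.comm (L s) (L t).
  apply/eqP; rewrite -subr_eq0 rep_bracket //; try exact: is_sp_Lmat.
  by rewrite !Lmat_mul0 subrr rep0.
have phiM : {morph phi : x y / x * y}.
  have fC c z : GRing.comm (@scalar_mx C m.+1 c) z by apply/esym/scalar_mxC.
  by move=> x y; apply: (mmapM_commuting LC fC).
have phi1 : phi 1 = 1 by rewrite /phi /= -mpolyC1 mmapC.
have phiL i j : phi (Lvar C i j) = rho (Lmat C i j).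
  rewrite /phi /= /Lvar; case: ifP => _; rewrite mmapX mmap1U /L enum_rankK //.
  by rewrite LmatC.
suff phiP k : phi (Pk C (I k)) = 0.
  rewrite -[LHS]/(phi _) raddf_sum big1 // => k _.
  by rewrite phiM phiP mulr0.
(* The lowering operators are the images of the matrix units E_j1 of gl(g). What remains is the
   absence of torsion, the commutator with [Lvar], and the vanishing of [L_11^(n+1)]. *)
apply: (Pk_vanish (phi := phi) (Y := fun j => rho (root_vec_A C j i0)) (i := i0)) => //.
- move=> r x /eqP; rewrite -scaler_nat scaler_eq0 pnatr_eq0 /=.
  by move/eqP.
- move=> j u w _; rewrite raddfD !raddfMn /= !phiL.
  rewrite (rep_bracket hrep) ?bracket_root_A_Lmat;
    try solve [exact: is_sp_root_A|exact: is_sp_Lmat].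
  rewrite -!scaler_nat repD ?repZ //; try apply: is_spZ; exact: is_sp_Lmat.
have -> : phi (Lvar C i0 i0 ^+ n.+1) = rho (Lmat C i0 i0) ^+ n.+1.
  by elim: n.+1 => [|r IHr]; rewrite ?expr0 // !exprS phiM IHr phiL.
have [v [v0 [hH [hA hB]]]] := hw.
have hv := highest_layer hrep i0_min hH hA hB.
have E0 (x : 'cV_m.+1) : rho (Lmat C i0 i0) ^+ n.+1 *m x = 0.
  have gE : rep_deg rho i0 2 (rho (Lmat C i0 i0)).
    by exists (Lmat C i0 i0) => //; apply: sp_deg_E.
  have gF : rep_deg rho i0 (-2) (rho (root_vec_C C i0)).
    by exists (root_vec_C C i0) => //; apply: sp_deg_F.
  have gEF := rep_bracket hrep (is_sp_Lmat C i0 i0) (is_sp_root_C C i0).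
  rewrite bracket_EF in gEF.
  apply: (layer_sum_expr0 (@rep_deg_bracketH _ _ _ _ hrep i0) (@rep_deg_bracket _ _ _ _ hrep i0)
    gE gF gEF (hn i0)).
  exact: (irreducible_layer_sum hrep hirr v0 hv).
by apply/matrixP => i j; have /matrixP/(_ i 0) := E0 (delta_mx j 0); rewrite -colE !mxE.
Qed.
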